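(* Let $U_{k+1}=F(U_k)$, $k\ge0$, be standard Q-value iteration with $U_0=Q_0$, and let $(Q_k)_{k\ge0}$ be generated from the same initialization $Q_0\in\mathbb R^n$ by deflated Q-value iteration \[ Q_{k+1}=F(Q_k)+\frac{\gamma}{1-\gamma}\Big(\frac1n\mathbf 1^\top(F(Q_k)-Q_k)\Big)\mathbf 1 . \] Then there exist scalars $c_k\in\mathbb R$ such that $Q_k=U_k+c_k\mathbf 1$ for all $k\ge0$. Consequently, \[ \boldsymbol{\Pi}_\perp Q_k=\boldsymbol{\Pi}_\perp U_k,\qquad \pi_{Q_k}=\pi_{U_k},\qquad\forall k\ge0, \] under the same tie-breaking rule.
   Context: Setting: a finite discounted Markov decision process with finite nonempty state space $\mathcal S$, finite nonempty action space $\mathcal A$, transition probabilities $P(s'\mid s,a)$, real rewards $r(s,a,s')$, discount factor $\gamma\in(0,1)$, and expected reward $R(s,a):=\sum_{s'}P(s'\mid s,a)r(s,a,s')$. Put $n:=|\mathcal S||\mathcal A|$; vectors in $\mathbb R^n$ are indexed by pairs $(s,a)$. The Bellman optimality operator $F:\mathbb R^n\to\mathbb R^n$ is $(FQ)(s,a):=R(s,a)+\gamma\sum_{s'}P(s'\mid s,a)\max_{a'}Q(s',a')$. $\mathbf 1$ is the all-ones vector and $\boldsymbol{\Pi}_\perp:=I-\frac1n\mathbf 1\mathbf 1^\top$. For $Q\in\mathbb R^n$, the tie-broken greedy policy $\pi_Q:\mathcal S\to\mathcal A$ is $\pi_Q(s):=\arg\max_{a\in\mathcal A}Q(s,a)$,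 where ties are resolved by a fixed tie-breaking rule, i.e. a fixed choice of one element from each nonempty set of maximizing actions (depending only on the state and on the set of maximizers). *)

(* Defs.v *)
From HB Require Import structures.
From mathcomp Require Import all_boot all_order all_algebra.

Set Implicit Arguments.
Unset Strict Implicit.
Unset Printing Implicit Defensive.

Import Order.TTheory GRing.Theory Num.Theory.
Local Open Scope ring_scope.

(* [trans M s a s'] is P(s' | s, a): the successor state comes last. *)
Record mdp (R : realFieldType) (S A : finType) := MDP {
  trans : S -> A -> S -> R;
  reward : S -> A -> S -> R;
  discount : R;
  states_gt0 : (0 < #|S|)%N;
  actions_gt0 : (0 < #|A|)%N;
  trans_ge0 : forall s a s', 0 <= trans s a s';
  trans_sum1 : forall s a, \sum_s' trans s a s' = 1;
  discount_gt0 : 0 < discount;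
  discount_lt1 : discount < 1 }.

(* Vectors of R^n are column vectors whose coordinates are matched with the
   pairs (s, a) by [enum_rank] and [enum_val]. *)
Notation dimQ S A := #|{: S * A}|.
Notation qvec R S A := 'cV[R]_(dimQ S A).

Section Definitions.
Variables (R : realFieldType) (S A : finType).
Implicit Types (M : mdp R S A) (Q : qvec R S A).

Lemma dimQE : dimQ S A = (#|S| * #|A|)%N.
Proof. exact: card_prod. Qed.

Definition qval Q (s : S) (a : A) : R := Q (enum_rank (s, a)) 0.

Definition qvec_of (f : S -> A -> R) : qvec R S A :=
  \col_i f (enum_val i).1 (enum_val i).2.

Lemma qval_of f s a : qval (qvec_of f) s a = f s a.
Proof. by rewrite /qval mxE enum_rankK. Qed.

Definition expected_reward M s a : R :=
  \sum_s' trans M s a s' * reward M s a s'.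

(* Some action, used only to start the iterated maximum below. *)
Definition base_action M : A := enum_val (Ordinal (actions_gt0 M)).

Definition max_qval M Q (s : S) : R :=
  \big[Num.max/qval Q s (base_action M)]_(a : A) qval Q s a.

Lemma max_qvalP M Q s :
  (forall a, qval Q s a <= max_qval M Q s) /\
  (exists a, max_qval M Q s = qval Q s a).
Proof.
split=> [a|]; first exact: le_bigmax.
rewrite /max_qval; elim/big_ind: _ => [|x y [a ->] [b ->]|a _].
- by exists (base_action M).
- by rewrite /Num.max; case: ifP => _; [exists b | exists a].
- by exists a.
Qed.

Definition bellman M Q : qvec R S A :=
  qvec_of (fun s a => expected_reward M s a +
    discount M * \sum_s' trans M s a s' * max_qval M Q s').

Definition ones : qvec R S A := const_mx 1.

(* The product [ones^T *m Q] is a 1 x 1 matrix, read off at (0, 0). *)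
Definition mean Q : R := (dimQ S A)%:R^-1 * (ones^T *m Q) 0 0.

Definition proj_perp : 'M[R]_(dimQ S A) :=
  1%:M - (dimQ S A)%:R^-1 *: (ones *m ones^T).

Definition deflated_bellman M Q : qvec R S A :=
  bellman M Q +
  (discount M / (1 - discount M) * mean (bellman M Q - Q)) *: ones.

Definition maximizers Q (s : S) : {set A} :=
  [set a | [forall b, qval Q s b <= qval Q s a]].

Definition tie_breaking_rule (tb : S -> {set A} -> A) : Prop :=
  forall s (B : {set A}), B != set0 -> tb s B \in B.

Definition greedy (tb : S -> {set A} -> A) Q : {ffun S -> A} :=
  [ffun s => tb s (maximizers Q s)].

End Definitions.

Arguments ones {R S A}.
Arguments proj_perp {R S A}.

(* Main.v *)
Require Import Defs.
From mathcomp Require Import all_boot all_order all_algebra.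

Set Implicit Arguments.
Unset Strict Implicit.
Unset Printing Implicit Defensive.

Import Order.TTheory GRing.Theory Num.Theory.
Local Open Scope ring_scope.

(** The Bellman optimality operator commutes with constant shifts up to the
    discount: the maximum over actions moves with the shift and each row of
    transition probabilities sums to one, so F(Q + x 1) = F(Q) + gamma x 1
    ([bellman_shift]).  The deflation term is itself a multiple of the all-ones
    vector, whatever its coefficient, so it can never move the deflated iterate
    off the line U_k + R 1; the offset obeys the scalar recursion
    c_(k+1) = gamma c_k + (deflation coefficient at Q_k), with c_0 = 0.
    The projection kills the all-ones vector ([proj_perp_ones]), and the set of
    maximizing actions, hence the tie-broken greedy policy, depends only on
    differences of Q-values at a given state ([greedy_shift]). *)

Section Shift.
Variables (R : realFieldType) (S A : finType).
Implicit Types (M : mdp R S A) (Q : qvec R S A) (x : R).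

Lemma qval_shift Q x s a : qval (Q + x *: ones) s a = qval Q s a + x.
Proof. by rewrite /qval !mxE mulr1. Qed.

(** The iterated maximum starts from a Q-value, which is shifted along with the
    others, so the shift goes through every binary maximum. *)
Lemma max_qval_shift M Q x s :
  max_qval M (Q + x *: ones) s = max_qval M Q s + x.
Proof.
rewrite /max_qval.
apply: (big_rec2 (fun u v => u = v + x)) => [|a u v _ ->]; rewrite qval_shift //.
by rewrite addr_maxl.
Qed.

(** The expectation of the constant [x] under a probability row is [x], which
    leaves only the discount in front of it. *)
Lemma bellman_shift M Q x :
  bellman M (Q + x *: ones) = bellman M Q + (discount M * x) *: ones.
Proof.
apply/matrixP => i j; rewrite !mxE mulr1 -addrA -mulrDr.
congr (_ + _ * _).
under eq_bigr => s' _ do rewrite max_qval_shift mulrDr.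
by rewrite big_split /= -mulr_suml trans_sum1 mul1r.
Qed.

(** [ones^T *m ones] is the dimension, cancelled by the normalization unless it
    is zero; in dimension zero all column vectors agree. *)
Lemma proj_perp_ones : proj_perp *m (ones : qvec R S A) = 0.
Proof.
have ones_dot : (ones : qvec R S A)^T *m ones = (dimQ S A)%:R%:M.
  apply/matrixP => i j; rewrite !ord1 !mxE mulr1n.
  under eq_bigr => k _ do rewrite !mxE mulr1.
  by rewrite sumr_const card_ord.
apply/matrixP => i j.
(* The mere existence of the row index [i] makes the dimension positive. *)
have n_neq0 : (dimQ S A)%:R != 0 :> R.
  by rewrite pnatr_eq0 -lt0n (leq_ltn_trans _ (ltn_ord i)).
rewrite /proj_perp mulmxBl mul1mx -scalemxAl -mulmxA ones_dot mul_mx_scalar.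
by rewrite scalerA mulVf // scale1r subrr.
Qed.

Lemma proj_perp_shift Q x :
  proj_perp *m (Q + x *: ones) = proj_perp *m Q.
Proof. by rewrite mulmxDr -scalemxAr proj_perp_ones scaler0 addr0. Qed.

Lemma maximizers_shift Q x s : maximizers (Q + x *: ones) s = maximizers Q s.
Proof.
apply/setP => a; rewrite !inE; apply: eq_forallb => b.
by rewrite !qval_shift lerD2r.
Qed.

(** A tie-breaking rule sees only the state and the set of maximizers, so equal
    sets of maximizers give equal, not merely equally good, policies. *)
Lemma greedy_shift (tb : S -> {set A} -> A) Q x :
  greedy tb (Q + x *: ones) = greedy tb Q.
Proof. by apply/ffunP => s; rewrite !ffunE maximizers_shift. Qed.

End Shift.

Theorem lemma9 (R : realFieldType) (S A : finType) (M : mdp R S A)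
    (tb : S -> {set A} -> A) (Htb : tie_breaking_rule tb)
    (Q0 : 'cV[R]_#|{: S * A}|) (U Q : nat -> 'cV[R]_#|{: S * A}|)
    (HU0 : U 0%N = Q0) (HU : forall k : nat, U k.+1 = bellman M (U k))
    (HQ0 : Q 0%N = Q0) (HQ : forall k : nat, Q k.+1 = deflated_bellman M (Q k)) :
  (exists c : nat -> R, forall k : nat, Q k = U k + c k *: ones) /\
  (forall k : nat,
     proj_perp *m Q k = proj_perp *m U k /\ greedy tb (Q k) = greedy tb (U k)).
Proof.
have [c Qc] : exists c : nat -> R, forall k : nat, Q k = U k + c k *: ones.
  (* The offset is computed along the given sequence [Q]: the shift inherited
     from the previous step is discounted and the deflation term is added. *)
  pose step k x := discount M * x +
    discount M / (1 - discount M) * mean (bellman M (Q k) - Q k).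
  exists (fix c k := if k is k'.+1 then step k' (c k') else 0).
  elim=> [|k IHk]; first by rewrite scale0r addr0 HQ0 HU0.
  rewrite HQ HU /deflated_bellman {1}IHk bellman_shift /step.
  by rewrite -addrA -scalerDl.
split; first by exists c.
by move=> k; rewrite Qc proj_perp_shift greedy_shift.
Qed.
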